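(* Let $X$ be a path connected topological space with base point $x_0$, let $H\unlhd\pi_1(X,x_0)$ be a normal subgroup, and suppose that $X$ is $H$-SLT at $x_0$. Then $X$ is homotopically path Hausdorff relative to $H$ if and only if $X$ is homotopically Hausdorff relative to $H$.
   Context: Let $\ast$ denote concatenation of paths and $\alpha^{-1}$ the reverse path; $P(X,x_0)$ is the set of paths in $X$ starting at $x_0$. For $H\le\pi_1(X,x_0)$ and $\alpha,\beta\in P(X,x_0)$, write $[\alpha]_H=[\beta]_H$ iff $\alpha(1)=\beta(1)$ and $[\alpha\ast\beta^{-1}]\in H$. $X$ is $H$-SLT at $x_0$ if for every path $\alpha$ in $X$ beginning at $x_0$ and every open set $U\ni x_0$ there is an open set $V\ni\alpha(1)$ such that for every loop $\beta$ in $V$ based at $\alpha(1)$ there is a loop $\gamma$ in $U$ based at $x_0$ with $[\alpha\ast\beta\ast\alpha^{-1}]_H=[\gamma]_H$. $X$ is homotopically Hausdorff relative to $H$ if for every $x\in X$, every $\alpha\in P(X,x_0)$ with $\alpha(1)=x$, and every $g\in\pi_1(X,x_0)\setminus H$, there is an open neighborhood $U_g$ of $\alpha(1)$ in which there is no loop $\gamma$ based at $\alpha(1)$ with $[\alpha\ast\gamma\ast\alpha^{-1}]\in Hg$. $X$ is homotopically path Hausdorff relative to $H$ if for every pair $\alpha,\beta\in P(X,x_0)$ with $\alpha(1)=\beta(1)$ and $[\alpha\ast\beta^{-1}]\notin H$ there are a partition $0=t_0<t_1<\dots<t_n=1$ and open sets $U_1,\dots,U_n$ with $\alpha([t_{i-1},t_i])\subseteq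 U_i$ such that for every path $\gamma:[0,1]\to X$ with $\gamma([t_{i-1},t_i])\subseteq U_i$ for $1\le i\le n$ and $\gamma(t_i)=\alpha(t_i)$ for $0\le i\le n$ one has $[\gamma\ast\beta^{-1}]\notin H$. *)

(* Defs.v *)
From HB Require Import structures.
From mathcomp Require Import all_boot all_order all_algebra.
From mathcomp Require Import generic_quotient monoid.
From mathcomp Require Import all_classical all_reals.
From mathcomp Require Import topology normedtype homotopy.
From mathcomp Require Import lra.

Set Implicit Arguments.
Unset Strict Implicit.
Unset Printing Implicit Defensive.

Import Order.TTheory GRing.Theory Num.Theory.
Import numFieldNormedType.Exports.

Local Open Scope classical_set_scope.
Local Open Scope ring_scope.
Local Open Scope quotient_scope.

Section unit_interval.
Context {R : realType}.

(* paths are those of the library, with this interval as their domain *)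
Definition unit_interval : Type := set_type `[0%R, 1%R : R]%classic.

HB.instance Definition _ := SubType.on unit_interval.
HB.instance Definition _ := Choice.on unit_interval.
HB.instance Definition _ := Topological.on unit_interval.

Implicit Types (s : unit_interval) (r : R).

Definition ui_val s : R := \val s.

Lemma ui_val_inj : injective ui_val.
Proof. exact: val_inj. Qed.

Definition clamp_fun r : R := Num.min (Num.max r 0) 1.

Lemma clamp_subproof r : clamp_fun r \in `[0, 1]%classic.
Proof.
rewrite inE /= in_itv /= /clamp_fun; apply/andP; split.
  by rewrite le_min ler01 le_max lexx orbT.
by rewrite ge_min lexx orbT.
Qed.

(* the retraction of the line onto the unit interval *)
Definition clamp r : unit_interval := Sub (clamp_fun r) (clamp_subproof r).

Lemma ui_itv s : 0 <= ui_val s <= 1.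
Proof. by have := valP s; rewrite inE /= in_itv. Qed.

Lemma clampE r : 0 <= r <= 1 -> ui_val (clamp r) = r.
Proof.
move=> /andP[r0 r1]; rewrite /ui_val /= /clamp_fun (max_idPl r0).
exact/min_idPl.
Qed.

Lemma clamp_val s : clamp (ui_val s) = s.
Proof. by apply: ui_val_inj; rewrite clampE// ui_itv. Qed.

Lemma clamp0_neq1 : clamp 0 != clamp 1.
Proof.
apply/eqP => /(congr1 ui_val).
by rewrite !clampE ?lexx ?ler01// => /eqP; rewrite eq_sym oner_eq0.
Qed.

HB.instance Definition _ :=
  isBiPointed.Build unit_interval clamp0_neq1.

Lemma val_zero : ui_val (zero : unit_interval) = 0.
Proof. by rewrite [zero]/(clamp 0) clampE// lexx ler01. Qed.

Lemma val_one : ui_val (one : unit_interval) = 1.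
Proof. by rewrite [one]/(clamp 1) clampE// lexx ler01. Qed.

Lemma val_continuous : continuous ui_val.
Proof. exact: initial_continuous. Qed.

Lemma clamp_continuous : continuous clamp.
Proof.
apply: continuous_comp_initial => r.
apply: (@continuous_min _ _ (fun r => Num.max r 0) (cst 1)).
  by apply: (@continuous_max _ _ id (cst 0)); [exact: cvg_id|exact: cvg_cst].
exact: cvg_cst.
Qed.

End unit_interval.
Arguments unit_interval : clear implicits.

Lemma continuous_clamp (R : realType) (S : topologicalType) (f : S -> R) :
  continuous f -> continuous (fun x => clamp (f x)).
Proof.
by move=> cf x; apply: continuous_comp; [exact: cf|exact: clamp_continuous].
Qed.

Section continuous_arithmetic.
Context {R : realType} {S : topologicalType}.
Implicit Types f g : S -> R.

Lemma continuous_addf f g :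
  continuous f -> continuous g -> continuous (fun x => f x + g x).
Proof. by move=> cf cg x; exact: cvgD (cf x) (cg x). Qed.

Lemma continuous_subf f g :
  continuous f -> continuous g -> continuous (fun x => f x - g x).
Proof. by move=> cf cg x; exact: cvgB (cf x) (cg x). Qed.

Lemma continuous_mulf f g :
  continuous f -> continuous g -> continuous (fun x => f x * g x).
Proof. by move=> cf cg x; exact: cvgM (cf x) (cg x). Qed.

Lemma continuous_maxf f g :
  continuous f -> continuous g -> continuous (fun x => Num.max (f x) (g x)).
Proof. by move=> cf cg x; exact: continuous_max (cf x) (cg x). Qed.

Lemma continuous_minf f g :
  continuous f -> continuous g -> continuous (fun x => Num.min (f x) (g x)).
Proof. by move=> cf cg x; exact: continuous_min (cf x) (cg x). Qed.

End continuous_arithmetic.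

Lemma continuous_pasting (R : realType) (S T : topologicalType)
    (v : S -> R) (c : R) (f g : S -> T) :
    continuous v -> continuous f -> continuous g ->
    (forall x, v x = c -> f x = g x) ->
  continuous (fun x => if v x <= c then f x else g x).
Proof.
move=> cv cf cg fg x U /=; have [vxc|vxc|vxc] := ltgtP (v x) c => Ux.
- have vc : \forall y \near x, v y < c by exact: (cvgr_lt (v x) (cv x)).
  have Uf : \forall y \near x, U (f y) := cf x _ Ux.
  change (\forall y \near x, U (if v y <= c then f y else g y)).
  by near=> y; rewrite ltW; near: y.
- have vc : \forall y \near x, c < v y by exact: (cvgr_gt (v x) (cv x)).
  have Ug : \forall y \near x, U (g y) := cg x _ Ux.
  change (\forall y \near x, U (if v y <= c then f y else g y)).
  by near=> y; rewrite leNgt (_ : c < v y)//=; near: y.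
- have Uf : \forall y \near x, U (f y) := cf x _ Ux.
  have Ug : \forall y \near x, U (g y).
    by rewrite (fg _ vxc) in Ux; exact: cg x _ Ux.
  change (\forall y \near x, U (if v y <= c then f y else g y)).
  by near=> y; case: ifP => _; near: y.
Unshelve. all: by end_near. Qed.

Local Notation path R x y := {path (unit_interval R) from x to y}.

Section path_operations.
Context {R : realType} {X : topologicalType}.
Implicit Types x y z : X.
Local Notation I := (unit_interval R).

Lemma path_continuous x y (f : path R x y) : continuous f.
Proof. exact: cts_fun. Qed.

Lemma path_clamp_continuous (S : topologicalType) x y (f : path R x y)
  (r : S -> R) : continuous r -> continuous (fun p => f (clamp (r p))).
Proof.
move=> cr p; apply: (@continuous_comp _ _ _ (fun p => clamp (r p)) f).
  exact: continuous_clamp.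
exact: path_continuous.
Qed.

Lemma path_clamp0 x y (f : path R x y) : f (clamp 0) = x.
Proof. exact: path_zero. Qed.

Lemma path_clamp1 x y (f : path R x y) : f (clamp 1) = y.
Proof. exact: path_one. Qed.

Definition concat_fun x y z (f : path R x y) (g : path R y z) (s : I) : X :=
  if ui_val s <= 2^-1 then f (clamp (2 * ui_val s))
  else g (clamp (2 * ui_val s - 1)).

Section concat.
Context {x y z : X} (f : path R x y) (g : path R y z).

Lemma concat_continuous : continuous (concat_fun f g).
Proof.
apply: (@continuous_pasting R _ _ ui_val).
- exact: val_continuous.
- apply: path_clamp_continuous.
  by apply: continuous_mulf; [exact: cst_continuous|exact: val_continuous].
- apply/path_clamp_continuous/continuous_subf; last exact: cst_continuous.
  by apply: continuous_mulf; [exact: cst_continuous|exact: val_continuous].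
- by move=> s ->; rewrite divff ?pnatr_eq0// subrr path_clamp1 path_clamp0.
Qed.

Lemma concat_zero : concat_fun f g zero = x.
Proof. by rewrite /concat_fun val_zero mulr0 path_clamp0 invr_ge0 ler0n. Qed.

Lemma concat_one : concat_fun f g one = z.
Proof.
rewrite /concat_fun val_one.
have -> : (1 <= 2^-1 :> R) = false by lra.
by rewrite (_ : 2 * 1 - 1 = 1 :> R) ?path_clamp1//; lra.
Qed.

Definition concat : path R x z :=
  mk_path concat_continuous concat_zero concat_one.

End concat.

Definition reverse_fun x y (f : path R x y) (s : I) : X :=
  f (clamp (1 - ui_val s)).

Section reverse.
Context {x y : X} (f : path R x y).

Lemma reverse_continuous : continuous (reverse_fun f).
Proof.
apply: path_clamp_continuous.
by apply: continuous_subf; [exact: cst_continuous|exact: val_continuous].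
Qed.

Lemma reverse_zero : reverse_fun f zero = y.
Proof. by rewrite /reverse_fun val_zero subr0 path_clamp1. Qed.

Lemma reverse_one : reverse_fun f one = x.
Proof. by rewrite /reverse_fun val_one subrr path_clamp0. Qed.

Definition reverse : path R y x :=
  mk_path reverse_continuous reverse_zero reverse_one.

End reverse.

Lemma cst_zero x : cst x (zero : I) = x. Proof. by []. Qed.
Lemma cst_one x : cst x (one : I) = x. Proof. by []. Qed.

Definition const_path x : path R x x :=
  mk_path (@cst_continuous I X x) (cst_zero x) (cst_one x).

Definition homotopic x y (f g : path R x y) : Prop :=
  exists F : I * I -> X,
    [/\ continuous F,
        forall s, F (s, zero) = f s,
        forall s, F (s, one) = g s,
        forall t, F (zero, t) = x
      & forall t, F (one, t) = y].

Lemma homotopic_refl x y (f : path R x y) : homotopic f f.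
Proof.
exists (fun p => f p.1).
split=> [|//|//|t|t]; [|exact: path_zero|exact: path_one].
move=> p; apply: (@continuous_comp _ _ _ fst f); first exact: cvg_fst.
exact: path_continuous.
Qed.

Lemma val_fst_continuous : continuous (fun p : I * I => ui_val p.1 : R).
Proof.
by move=> p; apply: continuous_comp; [exact: cvg_fst|exact: val_continuous].
Qed.

Lemma val_snd_continuous : continuous (fun p : I * I => ui_val p.2 : R).
Proof.
by move=> p; apply: continuous_comp; [exact: cvg_snd|exact: val_continuous].
Qed.

Lemma continuous_compI2 (F : I * I -> X) (a b : I * I -> I) :
  continuous F -> continuous a -> continuous b ->
  continuous (fun p => F (a p, b p)).
Proof.
move=> cF ca cb p; apply: (@continuous_comp _ _ _ (fun p => (a p, b p)) F).
  exact: (cvg_pair (ca p) (cb p)).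
exact: cF.
Qed.

Lemma homotopic_sym x y (f g : path R x y) : homotopic f g -> homotopic g f.
Proof.
move=> [F [cF F0 F1 Fx Fy]].
exists (fun p => F (p.1, clamp (1 - ui_val p.2))); split=> // [|s|s].
- apply: continuous_compI2 => //; first by move=> p; exact: cvg_fst.
  apply: continuous_clamp.
  apply: continuous_subf; first exact: cst_continuous.
  exact: val_snd_continuous.
- by rewrite /= val_zero subr0 F1.
- by rewrite /= val_one subrr F0.
Qed.

Lemma homotopic_trans x y (f g h : path R x y) :
  homotopic f g -> homotopic g h -> homotopic f h.
Proof.
move=> [F [cF F0 F1 Fx Fy]] [G [cG G0 G1 Gx Gy]].
exists (fun p => if ui_val p.2 <= 2^-1 :> R then F (p.1, clamp (2 * ui_val p.2))
                 else G (p.1, clamp (2 * ui_val p.2 - 1))).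
split=> [|s|s|t|t].
- apply: continuous_pasting.
  + exact: val_snd_continuous.
  + apply: continuous_compI2 => //; first by move=> p; exact: cvg_fst.
    apply: continuous_clamp.
    apply: continuous_mulf; first exact: cst_continuous.
    exact: val_snd_continuous.
  + apply: continuous_compI2 => //; first by move=> p; exact: cvg_fst.
    apply/continuous_clamp/continuous_subf; last exact: cst_continuous.
    apply: continuous_mulf; first exact: cst_continuous.
    exact: val_snd_continuous.
  + by move=> p ->; rewrite divff ?pnatr_eq0// subrr F1 G0.
- by rewrite /= val_zero mulr0 F0 invr_ge0 ler0n.
- rewrite /= val_one (_ : (1 <= 2^-1 :> R) = false); last by lra.
  by rewrite (_ : 2 * 1 - 1 = 1 :> R) ?G1//; lra.
- by rewrite /= Fx Gx if_same.
- by rewrite /= Fy Gy if_same.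
Qed.

Lemma homotopic_concat x y z (f f' : path R x y) (g g' : path R y z) :
  homotopic f f' -> homotopic g g' ->
  homotopic (concat f g) (concat f' g').
Proof.
move=> [F [cF F0 F1 Fx Fy]] [G [cG G0 G1 Gx Gy]].
exists (fun p => if ui_val p.1 <= 2^-1 :> R then F (clamp (2 * ui_val p.1), p.2)
                 else G (clamp (2 * ui_val p.1 - 1), p.2)).
split=> [|s|s|t|t].
- apply: continuous_pasting.
  + exact: val_fst_continuous.
  + apply: continuous_compI2 => //; last by move=> p; exact: cvg_snd.
    apply: continuous_clamp.
    apply: continuous_mulf; first exact: cst_continuous.
    exact: val_fst_continuous.
  + apply: continuous_compI2 => //; last by move=> p; exact: cvg_snd.
    apply/continuous_clamp/continuous_subf; last exact: cst_continuous.
    apply: continuous_mulf; first exact: cst_continuous.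
    exact: val_fst_continuous.
  + by move=> p ->; rewrite divff ?pnatr_eq0// subrr Fy Gx.
- by rewrite /= F0 G0.
- by rewrite /= F1 G1.
- by rewrite /= val_zero mulr0 Fx invr_ge0 ler0n.
- rewrite /= val_one (_ : (1 <= 2^-1 :> R) = false); last by lra.
  by rewrite (_ : 2 * 1 - 1 = 1 :> R) ?Gy//; lra.
Qed.

Lemma homotopic_reverse x y (f g : path R x y) :
  homotopic f g -> homotopic (reverse f) (reverse g).
Proof.
move=> [F [cF F0 F1 Fx Fy]].
exists (fun p => F (clamp (1 - ui_val p.1), p.2)).
split=> [|s|s|t|t]; [|exact: F0|exact: F1| |].
- apply: continuous_compI2 => //; last by move=> p; exact: cvg_snd.
  apply: continuous_clamp.
  apply: continuous_subf; first exact: cst_continuous.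
  exact: val_fst_continuous.
- by rewrite /= val_zero subr0 Fy.
- by rewrite /= val_one subrr Fx.
Qed.

(* The group laws below are instances of this lemma: two paths that traverse h
   along time changes with the same endpoints are homotopic. *)
Lemma homotopic_time_change x y u v (h : path R u v) (f g : path R x y)
    (a b : I -> R) :
    continuous a -> continuous b ->
    a zero = b zero -> a one = b one ->
    (forall s, f s = h (clamp (a s))) -> (forall s, g s = h (clamp (b s))) ->
  homotopic f g.
Proof.
move=> ca cb ab0 ab1 fE gE.
exists (fun p => h (clamp ((1 - ui_val p.2) * a p.1 + ui_val p.2 * b p.1))).
split=> [|s|s|t|t].
- apply/path_clamp_continuous/continuous_addf; apply: continuous_mulf.
  + apply: continuous_subf; first exact: cst_continuous.
    exact: val_snd_continuous.
  + move=> p; apply: (@continuous_comp _ _ _ fst a); first exact: cvg_fst.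
    exact: ca.
  + exact: val_snd_continuous.
  + move=> p; apply: (@continuous_comp _ _ _ fst b); first exact: cvg_fst.
    exact: cb.
- by rewrite /= val_zero subr0 mul1r mul0r addr0 fE.
- by rewrite /= val_one subrr mul1r mul0r add0r gE.
- by rewrite /= -ab0 -mulrDl subrK mul1r -fE path_zero.
- by rewrite /= -ab1 -mulrDl subrK mul1r -fE path_one.
Qed.

End path_operations.

Section reparametrisations.
Context {R : realType} {X : topologicalType}.
Implicit Types x y z w : X.
Local Notation I := (unit_interval R).

Lemma le_half (r : R) : (r <= 2^-1) = (2 * r <= 1).
Proof. by rewrite -[2^-1]mul1r ler_pdivlMr ?ltr0n// mulrC. Qed.

Lemma concatE x y z (f : path R x y) (g : path R y z) (s : I) :
  concat f g s =
    if 2 * ui_val s <= 1 then f (clamp (2 * ui_val s))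
    else g (clamp (2 * ui_val s - 1)).
Proof. by rewrite -le_half. Qed.

Lemma reverseE x y (f : path R x y) (s : I) :
  reverse f s = f (clamp (1 - ui_val s)).
Proof. by []. Qed.

Lemma homotopic_concatA x y z w
    (f : path R x y) (g : path R y z) (h : path R z w) :
  homotopic (concat f (concat g h)) (concat (concat f g) h).
Proof.
pose a (s : I) : R :=
  Num.max (Num.max (ui_val s / 2) (ui_val s - 4^-1)) (2 * ui_val s - 1).
apply: (@homotopic_time_change _ _ _ _ _ _ (concat (concat f g) h) _ _
  a ui_val).
- apply: continuous_maxf; first apply: continuous_maxf.
  + by apply: continuous_mulf; [exact: val_continuous|exact: cst_continuous].
  + by apply: continuous_subf; [exact: val_continuous|exact: cst_continuous].
  + apply: continuous_subf; last exact: cst_continuous.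
    by apply: continuous_mulf; [exact: cst_continuous|exact: val_continuous].
- exact: val_continuous.
- rewrite /a val_zero !mulr0 mul0r !sub0r.
  by rewrite !maxEle; do 2?case: ifP; lra.
- by rewrite /a val_one !maxEle; do 2?case: ifP; lra.
- move=> s; have /andP[s0 s1] := ui_itv s.
  have aE : a s = if 2 * ui_val s <= 1 then ui_val s / 2 else
      if 4 * ui_val s <= 3 then ui_val s - 4^-1 else 2 * ui_val s - 1.
    by rewrite /a !maxEle; do 4?case: ifP; lra.
  have aI : 0 <= a s <= 1 by rewrite aE; do 2?case: ifP; lra.
  rewrite [RHS]concatE [in LHS]concatE (clampE aI).
  case: ifPn => h1.
    have -> : 2 * a s = ui_val s by rewrite aE h1; lra.
    by rewrite s1 concatE clampE ?s0 ?s1// h1.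
  rewrite concatE clampE; last by lra.
  case: ifPn => h2.
    have -> : 2 * a s = 2 * ui_val s - 2^-1.
      by rewrite aE (negbTE h1); case: ifP; lra.
    rewrite ifT; last by lra.
    rewrite concatE clampE; last by lra.
    rewrite ifF; last by lra.
    by congr (g (clamp _)); lra.
  have -> : 2 * a s = 4 * ui_val s - 2.
    by rewrite aE (negbTE h1); case: ifP; lra.
  rewrite ifF; last by lra.
  by congr (h (clamp _)); lra.
- by move=> s; rewrite clamp_val.
Qed.

Lemma homotopic_concat_cstl x y (f : path R x y) :
  homotopic (concat (const_path x) f) f.
Proof.
apply: (@homotopic_time_change _ _ _ _ _ _ f _ _
  (fun s : I => Num.max 0 (2 * ui_val s - 1)) ui_val).
- apply: continuous_maxf; first exact: cst_continuous.
  apply: continuous_subf; last exact: cst_continuous.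
  by apply: continuous_mulf; [exact: cst_continuous|exact: val_continuous].
- exact: val_continuous.
- by rewrite val_zero !maxEle; case: ifP; lra.
- by rewrite val_one !maxEle; case: ifP; lra.
- move=> s; rewrite concatE maxEle; case: ifPn => h1; case: ifPn => h2.
  + by rewrite (_ : _ - 1 = 0) ?path_clamp0//; lra.
  + by rewrite path_clamp0.
  + by [].
  + by exfalso; lra.
- by move=> s; rewrite clamp_val.
Qed.

Lemma homotopic_concat_cstr x y (f : path R x y) :
  homotopic (concat f (const_path y)) f.
Proof.
apply: (@homotopic_time_change _ _ _ _ _ _ f _ _
  (fun s : I => Num.min (2 * ui_val s) 1) ui_val).
- apply: continuous_minf; last exact: cst_continuous.
  by apply: continuous_mulf; [exact: cst_continuous|exact: val_continuous].
- exact: val_continuous.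
- by rewrite val_zero !minEle; case: ifP; lra.
- by rewrite val_one !minEle; case: ifP; lra.
- move=> s; rewrite concatE minEle; case: ifPn => h1 //.
  by rewrite path_clamp1.
- by move=> s; rewrite clamp_val.
Qed.

Lemma homotopic_concat_reverse x y (f : path R x y) :
  homotopic (concat f (reverse f)) (const_path x).
Proof.
apply: (@homotopic_time_change _ _ _ _ _ _ f _ _
  (fun s : I => Num.min (2 * ui_val s) (2 - 2 * ui_val s)) (cst 0)).
- apply: continuous_minf.
    by apply: continuous_mulf; [exact: cst_continuous|exact: val_continuous].
  apply: continuous_subf; first exact: cst_continuous.
  by apply: continuous_mulf; [exact: cst_continuous|exact: val_continuous].
- exact: cst_continuous.
- by rewrite val_zero /cst minEle; case: ifP; lra.
- by rewrite val_one /cst minEle; case: ifP; lra.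
- move=> s; have := ui_itv s => sI.
  rewrite concatE reverseE minEle; case: ifPn => h1; case: ifPn => h2 //.
  + by exfalso; lra.
  + by exfalso; lra.
  + rewrite clampE; last by lra.
    by congr (f (clamp _)); lra.
- by move=> s; rewrite path_clamp0.
Qed.

Lemma reverseK x y (f : path R x y) : reverse (reverse f) = f.
Proof.
apply/path_eqP => s; have := ui_itv s => sI.
rewrite reverseE reverseE clampE; last by lra.
by rewrite opprB addrC subrK clamp_val.
Qed.

Lemma homotopic_reverse_concat x y (f : path R x y) :
  homotopic (concat (reverse f) f) (const_path y).
Proof.
by rewrite -[X in concat _ X]reverseK; exact: homotopic_concat_reverse.
Qed.

End reparametrisations.

Section fundamental_group.
Context (R : realType) {X : topologicalType}.
Implicit Types x : X.

Section path_classes.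
Context (x : X).

Let homotopic_rel (f g : path R x x) : bool := `[< homotopic f g >].

Let homotopic_rel_refl : reflexive homotopic_rel.
Proof. by move=> f; apply/asboolP; exact: homotopic_refl. Qed.

Let homotopic_rel_sym : symmetric homotopic_rel.
Proof. by move=> f g; apply/asboolP/asboolP; exact: homotopic_sym. Qed.

Let homotopic_rel_trans : transitive homotopic_rel.
Proof.
move=> g f h /asboolP fg /asboolP gh; apply/asboolP.
exact: homotopic_trans fg gh.
Qed.

Definition homotopic_equiv :=
  EquivRel homotopic_rel homotopic_rel_refl homotopic_rel_sym
    homotopic_rel_trans.

End path_classes.

Definition pi1 x : Type := {eq_quot (homotopic_equiv x)}.

HB.instance Definition _ x := Choice.on (pi1 x).
HB.instance Definition _ x := Quotient.on (pi1 x).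

Context {x : X}.

Definition loop_class (f : path R x x) : pi1 x := \pi_(pi1 x) f.

Lemma loop_classP (f g : path R x x) :
  loop_class f = loop_class g <-> homotopic f g.
Proof.
split=> [/eqmodP/asboolP//|fg].
by apply/eqmodP/asboolP.
Qed.

Lemma loop_class_repr (u : pi1 x) : loop_class (repr u) = u.
Proof. exact: reprK. Qed.

Definition pi1_one : pi1 x := loop_class (const_path x).
Definition pi1_mul (u v : pi1 x) : pi1 x :=
  loop_class (concat (repr u) (repr v)).
Definition pi1_inv (u : pi1 x) : pi1 x := loop_class (reverse (repr u)).

Let pi1_mulE (f g : path R x x) :
  pi1_mul (loop_class f) (loop_class g) = loop_class (concat f g).
Proof.
by apply/loop_classP/homotopic_concat; apply/loop_classP/loop_class_repr.
Qed.

Let pi1_invE (f : path R x x) :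
  pi1_inv (loop_class f) = loop_class (reverse f).
Proof. by apply/loop_classP/homotopic_reverse/loop_classP/loop_class_repr. Qed.

Let pi1_mulA : associative pi1_mul.
Proof.
move=> u v w; rewrite -[u]loop_class_repr -[v]loop_class_repr.
rewrite -[w]loop_class_repr !pi1_mulE.
exact/loop_classP/homotopic_concatA.
Qed.

Let pi1_1mul : left_id pi1_one pi1_mul.
Proof.
move=> u; rewrite -[u]loop_class_repr pi1_mulE.
exact/loop_classP/homotopic_concat_cstl.
Qed.

Let pi1_mul1 : right_id pi1_one pi1_mul.
Proof.
move=> u; rewrite -[u]loop_class_repr pi1_mulE.
exact/loop_classP/homotopic_concat_cstr.
Qed.

Let pi1_mulV : left_inverse pi1_one pi1_inv pi1_mul.
Proof.
move=> u; rewrite -[u]loop_class_repr pi1_invE pi1_mulE.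
exact/loop_classP/homotopic_reverse_concat.
Qed.

Let pi1_Vmul : right_inverse pi1_one pi1_inv pi1_mul.
Proof.
move=> u; rewrite -[u]loop_class_repr pi1_invE pi1_mulE.
exact/loop_classP/homotopic_concat_reverse.
Qed.

HB.instance Definition _ :=
  isGroup.Build (pi1 x) pi1_mulA pi1_1mul pi1_mul1 pi1_mulV pi1_Vmul.

Lemma loop_classM (f g : path R x x) :
  (loop_class f * loop_class g)%g = loop_class (concat f g).
Proof. exact: pi1_mulE. Qed.

Lemma loop_classV (f : path R x x) :
  ((loop_class f)^-1)%g = loop_class (reverse f).
Proof. exact: pi1_invE. Qed.

Lemma loop_class1 : loop_class (const_path x) = 1%g.
Proof. by []. Qed.

End fundamental_group.
Arguments pi1 R {X} x.
Arguments loop_class {R X x} f.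

Definition normal_subgroup (G : groupType) (H : set G) : Prop :=
  group_closed [in H] /\ forall g h : G, H h -> H (h ^ g)%g.

Definition path_connected (R : realType) (X : topologicalType) : Prop :=
  forall x y : X, inhabited (path R x y).

Section relative_properties.
Context {R : realType} {X : topologicalType} {x0 : X}.
Implicit Types (H : set (pi1 R x0)) (x : X) (U V : set X).
Local Notation I := (unit_interval R).

(* [alpha]_H = [beta]_H; the condition alpha(1) = beta(1) is carried by the
   common endpoint x of the two path types. *)
Definition path_eq_mod H x (alpha beta : path R x0 x) : Prop :=
  H (loop_class (concat alpha (reverse beta))).

Definition lasso x (alpha : path R x0 x) (beta : path R x x) : path R x0 x0 :=
  concat (concat alpha beta) (reverse alpha).

Definition H_SLT H : Prop :=
  forall x (alpha : path R x0 x) U, open U -> U x0 ->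
  exists V, [/\ open V, V x &
    forall beta : path R x x, range beta `<=` V ->
    exists2 gamma : path R x0 x0, range gamma `<=` U &
      path_eq_mod H (lasso alpha beta) gamma].

Definition homotopically_Hausdorff H : Prop :=
  forall x (alpha : path R x0 x) (g : pi1 R x0), ~ H g ->
  exists U, [/\ open U, U x &
    ~ exists2 gamma : path R x x, range gamma `<=` U &
        [set (h * g)%g | h in H] (loop_class (lasso alpha gamma))].

(* Open sets are numbered from 0: U i covers the piece between t i and t i.+1,
   and values of t and U beyond n are irrelevant. Typing gamma from x0 to x is
   no restriction, as gamma has to agree with alpha at t 0 = 0 and t n = 1. *)
Definition homotopically_path_Hausdorff H : Prop :=
  forall x (alpha beta : path R x0 x),
    ~ H (loop_class (concat alpha (reverse beta))) ->
  exists (n : nat) (t : nat -> I) (U : nat -> set X),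
    let piece i := [set s : I | ui_val (t i) <= ui_val s <= ui_val (t i.+1)] in
    [/\ t 0%N = zero,
        t n = one,
        forall i, (i < n)%N -> ui_val (t i) < ui_val (t i.+1),
        forall i, (i < n)%N -> open (U i) /\ alpha @` piece i `<=` U i
      & forall gamma : path R x0 x,
          (forall i, (i < n)%N -> gamma @` piece i `<=` U i) ->
          (forall i, (i <= n)%N -> gamma (t i) = alpha (t i)) ->
        ~ H (loop_class (concat gamma (reverse beta)))].

End relative_properties.

(* Main.v *)
Require Import Defs.
From mathcomp Require Import all_boot all_order all_algebra.
From mathcomp Require Import monoid.
From mathcomp Require Import all_classical all_reals topology.
From mathcomp Require Import interval_inference normedtype homotopy lra.
From Stdlib Require Setoid.

(** Path Hausdorff implies Hausdorff by a choice of beta and a time change.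
    Given alpha and a class g outside H, compare alpha with beta = d * alpha, where d represents
    g, so that [alpha * beta^-1] = g^-1 is not in H. The path Hausdorff
    condition yields a subdivision and open sets; the last of them, U, is the
    neighbourhood of alpha(1) that is needed. Indeed, if a loop k in U had
    [alpha * k * alpha^-1] = h g with h in H, then alpha * k could be
    reparametrised so as to follow alpha at its own times up to the last
    subdivision point and to stay in U afterwards ([insert_loop]), and its
    product with beta^-1 would have the class h g g^-1 = h, which is in H.

    The converse is where the SLT property enters. Let a = [alpha * beta^-1]
    be outside H. The Hausdorff property at the constant path gives an open U
    around x0 such that no loop in U has a class in H a^-1. By the SLT
    property, each point of alpha has a neighbourhood V whose loops, once
    transported to x0 along alpha, are H-equivalent to loops in U. One V serves
    all nearby points of alpha, since moving the base point along a piece of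
    alpha inside V only replaces a loop of V by another loop of V
    ([locally_tame]). Compactness of [0, 1] now gives a uniform subdivision
    with one such V for each piece. If gamma meets alpha at the subdivision
    points and follows the same open sets, then gamma * alpha^-1 factors, up to
    homotopy, into one transported loop for each piece, made of a piece of gamma
    and the reversed piece of alpha. As H is normal, classes that are
    H-equivalent to loops in U are closed under product ([small_modM]), so
    [gamma * alpha^-1] is H-equivalent to a loop in U
    ([subdivided_class_small]). If [gamma * beta^-1] =
    [gamma * alpha^-1] a were in H, that loop would have its class in H a^-1.

    Homotopies of paths between varying endpoints are turned into identities in
    the fundamental group by [based_class], which is multiplicative for
    concatenation. *)

Set Implicit Arguments.
Unset Strict Implicit.
Unset Printing Implicit Defensive.

Import Order.TTheory GRing.Theory Num.Theory.
Import numFieldNormedType.Exports.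

Local Open Scope classical_set_scope.
Local Open Scope ring_scope.

Local Notation path R x y := {path (unit_interval R) from x to y}.

(** * Homotopy as a congruence for path operations *)

#[local] Instance homotopic_equivalence (R : realType) (X : topologicalType)
    (x y : X) : RelationClasses.Equivalence (@homotopic R X x y).
Proof.
split=> [f|f g|f g h]; [exact: homotopic_refl|exact: homotopic_sym|].
exact: homotopic_trans.
Qed.

#[local] Instance concat_proper (R : realType) (X : topologicalType)
    (x y z : X) :
  Morphisms.Proper (Morphisms.respectful (@homotopic R X x y)
    (Morphisms.respectful (@homotopic R X y z) (@homotopic R X x z)))
    (@concat R X x y z).
Proof. by move=> f f' ff' g g' gg'; exact: homotopic_concat. Qed.

#[local] Instance reverse_proper (R : realType) (X : topologicalType)
    (x y : X) :
  Morphisms.Proper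
    (Morphisms.respectful (@homotopic R X x y) (@homotopic R X y x))
    (@reverse R X x y).
Proof. by move=> f g; exact: homotopic_reverse. Qed.

(** * Transporting paths to loops at the base point *)

Section based_class.
Context {R : realType} {X : topologicalType} {x0 : X}.
Implicit Types x y z : X.

(** The class p * f * q^-1. A choice of one path from x0 to each point makes
    this a functor from the fundamental groupoid to the fundamental group, which
    reduces homotopies of paths to computations in a group. *)
Definition based_class y z (p : path R x0 y) (q : path R x0 z)
    (f : path R y z) : pi1 R x0 :=
  loop_class (concat (concat p f) (reverse q)).

Lemma based_class_homotopic y z (p p' : path R x0 y) (q q' : path R x0 z)
    (f f' : path R y z) :
  homotopic p p' -> homotopic q q' -> homotopic f f' ->
  based_class p q f = based_class p' q' f'.
Proof.
by move=> pp' qq' ff'; apply/loop_classP; rewrite pp' qq' ff'; reflexivity.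
Qed.

Lemma based_class_lasso y (p : path R x0 y) (f : path R y y) :
  loop_class (lasso p f) = based_class p p f.
Proof. by []. Qed.

Lemma based_class_cst y (p q : path R x0 y) :
  based_class p q (const_path y) = loop_class (concat p (reverse q)).
Proof. by apply/loop_classP; rewrite homotopic_concat_cstr; reflexivity. Qed.

Lemma based_class_id y (p : path R x0 y) : based_class p p (const_path y) = 1%g.
Proof.
rewrite based_class_cst -loop_class1; apply/loop_classP.
exact: homotopic_concat_reverse.
Qed.

Lemma based_class_prefix y z (p : path R x0 y) (f : path R y z) :
  based_class p (concat p f) f = 1%g.
Proof.
rewrite -loop_class1; apply/loop_classP; exact: homotopic_concat_reverse.
Qed.

(** The detour q^-1 * q through the base point cancels. *)
Lemma based_class_concat y z w (p : path R x0 y) (q : path R x0 z)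
    (r : path R x0 w) (f : path R y z) (g : path R z w) :
  based_class p r (concat f g) = (based_class p q f * based_class q r g)%g.
Proof.
rewrite loop_classM; apply/loop_classP.
rewrite !homotopic_concatA.
rewrite -(homotopic_concatA (concat p f) (reverse q) q).
rewrite homotopic_reverse_concat homotopic_concat_cstr.
reflexivity.
Qed.

Lemma based_class_reverse y z (p : path R x0 y) (q : path R x0 z)
    (f : path R y z) :
  based_class q p (reverse f) = (based_class p q f)^-1%g.
Proof.
apply: (@mulgI _ (based_class p q f)); rewrite mulgV -based_class_concat.
rewrite -(based_class_id p); apply: based_class_homotopic; try reflexivity.
exact: homotopic_concat_reverse.
Qed.

End based_class.

(** * Reparametrised paths and arcs of a path *)

Section reparametrisation.
Context {R : realType} {X : topologicalType}.
Implicit Types x y : X.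
Local Notation I := (unit_interval R).

Section reparametrised.
Context {x y : X} (f : path R x y) {a : I -> R}.
Hypotheses (ca : continuous a) (a0 : a zero = 0) (a1 : a one = 1).

Let reparametrised_zero : f (clamp (a zero)) = x.
Proof. by rewrite a0 path_clamp0. Qed.

Let reparametrised_one : f (clamp (a one)) = y.
Proof. by rewrite a1 path_clamp1. Qed.

Definition reparametrised : path R x y :=
  mk_path (path_clamp_continuous (f := f) ca)
    reparametrised_zero reparametrised_one.

Lemma reparametrisedE s : reparametrised s = f (clamp (a s)).
Proof. by []. Qed.

Lemma homotopic_reparametrised : homotopic reparametrised f.
Proof.
apply: (@homotopic_time_change _ _ _ _ _ _ f _ _ a ui_val) => //.
- exact: val_continuous.
- by rewrite a0 val_zero.
- by rewrite a1 val_one.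
- by move=> s; rewrite clamp_val.
Qed.

End reparametrised.

End reparametrisation.

Section arc.
Context {R : realType} {X : topologicalType}.
Implicit Types x y u v : X.
Local Notation I := (unit_interval R).

(** The values a and b come in either order: an arc may run backwards. *)
Definition arc_time (a b : R) (s : I) : R := a + ui_val s * (b - a).

Lemma arc_time_continuous a b : continuous (arc_time a b).
Proof.
apply: continuous_addf; first exact: cst_continuous.
by apply: continuous_mulf; [exact: val_continuous|exact: cst_continuous].
Qed.

(** The endpoints u and v are linked to f by equations, so that arcs of two
    different paths that meet at a point have types that can be concatenated. *)
Section arc_def.
Context {x y u v : X} (f : path R x y) (a b : R).
Hypotheses (fa : f (clamp a) = u) (fb : f (clamp b) = v).

Let arc_zero : f (clamp (arc_time a b zero)) = u.
Proof. by rewrite /arc_time val_zero mul0r addr0. Qed.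

Let arc_one : f (clamp (arc_time a b one)) = v.
Proof. by rewrite /arc_time val_one mul1r addrC subrK. Qed.

Definition arc : path R u v :=
  mk_path (path_clamp_continuous (f := f) (@arc_time_continuous a b))
    arc_zero arc_one.

End arc_def.

Lemma arcE x y u v (f : path R x y) a b (fa : f (clamp a) = u)
    (fb : f (clamp b) = v) s :
  arc fa fb s = f (clamp (arc_time a b s)).
Proof. by []. Qed.

Lemma homotopic_arc_concat x y u v w (f : path R x y) a b c
    (fa : f (clamp a) = u) (fb : f (clamp b) = v) (fc : f (clamp c) = w) :
  homotopic (concat (arc fa fb) (arc fb fc)) (arc fa fc).
Proof.
apply: (@homotopic_time_change _ _ _ _ _ _ f _ _ (fun s : I =>
  if 2 * ui_val s <= 1 then a + 2 * ui_val s * (b - a)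
  else b + (2 * ui_val s - 1) * (c - b)) (arc_time a c)).
- have c2 : continuous (fun s : I => 2 * ui_val s : R).
    by apply: continuous_mulf; [exact: cst_continuous|exact: val_continuous].
  apply: continuous_pasting => //.
  + apply: continuous_addf; first exact: cst_continuous.
    by apply: continuous_mulf => //; exact: cst_continuous.
  + apply: continuous_addf; first exact: cst_continuous.
    apply: continuous_mulf; last exact: cst_continuous.
    by apply: continuous_subf => //; exact: cst_continuous.
  + by move=> s ->; lra.
- exact: arc_time_continuous.
- by rewrite /arc_time val_zero mulr0 ler01 !mul0r.
- by rewrite /arc_time val_one ifF; lra.
- move=> s; have := ui_itv s => sI; rewrite concatE !arcE /arc_time.
  by case: ifPn => h; rewrite clampE//; lra.
- by [].
Qed.

Lemma arc_trivial x y u (f : path R x y) a (fa fa' : f (clamp a) = u) :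
  arc fa fa' = const_path u.
Proof. by apply/path_eqP => s; rewrite arcE /arc_time subrr mulr0 addr0. Qed.

Lemma arc_full x y (f : path R x y) (f0 : f (clamp 0) = x)
  (f1 : f (clamp 1) = y) : arc f0 f1 = f.
Proof.
by apply/path_eqP => s; rewrite arcE /arc_time add0r subr0 mulr1 clamp_val.
Qed.

Lemma range_arc x y u v (f : path R x y) a b (fa : f (clamp a) = u)
    (fb : f (clamp b) = v) (A : set X) :
  (forall r, (a <= r <= b) || (b <= r <= a) -> A (f (clamp r))) ->
  range (arc fa fb) `<=` A.
Proof.
move=> fA _ [s _ <-]; rewrite arcE; apply: fA.
have /andP[s0 s1] := ui_itv s; rewrite /arc_time.
have [ab|/ltW ba] := leP a b; apply/orP; [left|right]; nra.
Qed.

Lemma range_concat x y z (f : path R x y) (g : path R y z) (A : set X) :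
  range f `<=` A -> range g `<=` A -> range (concat f g) `<=` A.
Proof.
move=> fA gA _ [s _ <-]; rewrite concatE.
by case: ifP => _; [apply: fA|apply: gA]; eexists.
Qed.

End arc.

(** * Comparison of paths with common endpoints *)

Lemma loop_class_triangle (R : realType) (X : topologicalType) (x0 y : X)
    (p q r : path R x0 y) :
  loop_class (concat p (reverse r)) =
  (loop_class (concat p (reverse q)) * loop_class (concat q (reverse r)))%g.
Proof.
rewrite -!based_class_cst -based_class_concat.
apply: based_class_homotopic; try reflexivity.
by rewrite homotopic_concat_cstr; reflexivity.
Qed.

Lemma loop_class_swap (R : realType) (X : topologicalType) (x0 y : X)
    (p q : path R x0 y) :
  loop_class (concat q (reverse p)) = (loop_class (concat p (reverse q)))^-1%g.
Proof.
apply: (@mulgI _ (loop_class (concat p (reverse q)))).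
by rewrite mulgV -loop_class_triangle -based_class_cst based_class_id.
Qed.

Lemma lasso_cst (R : realType) (X : topologicalType) (x0 : X)
    (f : path R x0 x0) : loop_class (lasso (const_path x0) f) = loop_class f.
Proof.
apply/loop_classP.
have rcst : reverse (const_path x0) = const_path x0 :> path R x0 x0.
  exact/path_eqP.
by rewrite /lasso rcst homotopic_concat_cstr homotopic_concat_cstl; reflexivity.
Qed.

(** * Classes congruent to loops in a neighbourhood *)

Section normal_subgroup_theory.
Context {G : groupType} {H : set G}.
Hypothesis nH : normal_subgroup H.

Lemma normal_subgroup1 : H 1%g.
Proof. by case: nH => -[/set_mem]. Qed.

Lemma normal_subgroupM g h : H g -> H h -> H (g * h)%g.
Proof.
case: nH => cH _ Hg Hh; apply: set_mem.
by apply: (group_closedM cH); exact: mem_set.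
Qed.

Lemma normal_subgroupV g : H g -> H g^-1%g.
Proof.
case: nH => cH _ Hg; apply: set_mem.
by apply: (group_closedV cH); exact: mem_set.
Qed.

Lemma normal_subgroupJ g h : H h -> H (g * h * g^-1)%g.
Proof.
by case: nH => _ /(_ g^-1%g h) HJ /HJ; rewrite conjgE invgK mulgA.
Qed.

End normal_subgroup_theory.

Section small_classes.
Context {R : realType} {X : topologicalType} {x0 : X}.
Variables (H : set (pi1 R x0)) (U : set X).
Hypothesis nH : normal_subgroup H.

(** The set H * pi(U), with pi(U) the classes of the loops in U at x0; the SLT
    condition says that it contains certain lassos. *)
Definition small_mod (g : pi1 R x0) : Prop :=
  exists2 gamma : path R x0 x0, range gamma `<=` U &
    H (g * (loop_class gamma)^-1)%g.

Lemma small_mod1 : U x0 -> small_mod 1%g.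
Proof.
move=> Ux0; exists (const_path x0); first by move=> _ [s _ <-].
by rewrite loop_class1 mulgV; exact: normal_subgroup1.
Qed.

(** Normality lets the H-part of the second factor pass to the left of the
    first. *)
Lemma small_modM g h : small_mod g -> small_mod h -> small_mod (g * h)%g.
Proof.
move=> [f fU Hf] [k kU Hk]; exists (concat f k); first exact: range_concat.
rewrite -loop_classM invgM.
have -> : (g * h * ((loop_class k)^-1 * (loop_class f)^-1) =
    (g * (h * (loop_class k)^-1) * g^-1) * (g * (loop_class f)^-1))%g.
  by rewrite !mulgA mulgVK.
by apply: normal_subgroupM => //; exact: normal_subgroupJ.
Qed.

End small_classes.

Local Notation initial_arc f r :=
  (arc (path_clamp0 f) (erefl (f (clamp r)))).

(** * From Hausdorff to path Hausdorff *)

Section path_Hausdorff_of_Hausdorff.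
Context {R : realType} {X : topologicalType} {x0 : X}.
Implicit Types (H : set (pi1 R x0)) (U V : set X).

(** The SLT condition at f(r), for the set V. The path to f(r) is the
    initial arc of f, so that the condition makes sense for all r at once. *)
Definition tame H U V (x : X) (f : path R x0 x) (r : R) : Prop :=
  V (f (clamp r)) /\
  forall b : path R (f (clamp r)) (f (clamp r)), range b `<=` V ->
    small_mod H U (loop_class (lasso (initial_arc f r) b)).

Lemma path_line_continuous (x y : X) (f : path R x y) :
  continuous (fun r : R => f (clamp r)).
Proof. by apply: path_clamp_continuous => r; exact: cvg_id. Qed.

(** For s near r, a loop b in V at f(s) is carried to f(r) by the arc c of f
    from f(r) to f(s), which stays in V. Transport along f identifies b with
    c * b * c^-1, to which the SLT condition at f(r) applies. *)
Lemma locally_tame H U (x : X) (f : path R x0 x) :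
    H_SLT H -> open U -> U x0 ->
  forall r : R, exists V, open V /\ \forall s \near r, tame H U V f s.
Proof.
move=> slt oU Ux0 r.
have [V [oV Vr Vsmall]] := slt _ (initial_arc f r) U oU Ux0.
exists V; split=> //.
have /nbhs_ballP[e /= e0 eV] : \forall s \near r, V (f (clamp s)).
  exact: (@path_line_continuous _ _ f r) (open_nbhs_nbhs (conj oV Vr)).
apply/nbhs_ballP; exists e => //= s se; split; first exact: eV.
move=> b bV.
pose c := arc (erefl (f (clamp r))) (erefl (f (clamp s))).
have cV : range c `<=` V.
  apply: range_arc => q rqs; apply: eV; move: se.
  rewrite -!ball_normE /= !ltr_norml => /andP[? ?].
  by case/orP: rqs => /andP[? ?]; lra.
have rcV : range (reverse c) `<=` V by move=> _ [q _ <-]; exact: cV.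
(* The arcs to f(r) and f(s) differ by c, so that c is trivial once based. *)
have cone : based_class (initial_arc f r) (initial_arc f s) c = 1%g.
  rewrite -(based_class_prefix (initial_arc f r) c).
  apply: based_class_homotopic; try reflexivity.
  by symmetry; exact: homotopic_arc_concat.
have [|k kU Hk] := Vsmall (concat (concat c b) (reverse c)).
  by do 2?apply: range_concat.
exists k => //; move: Hk.
rewrite /path_eq_mod -loop_classM -loop_classV !based_class_lasso.
rewrite (based_class_concat _ (initial_arc f s)).
rewrite (based_class_concat _ (initial_arc f s)).
by rewrite based_class_reverse cone mul1g invg1 mulg1.
Qed.

(** Lebesgue's number lemma for the unit segment, stated for a property of sets
    that passes to subsets instead of for a cover. *)
Lemma segment_lebesgue_number (P : set R -> Prop) :
    (forall A B : set R, A `<=` B -> P B -> P A) ->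
    (forall r : R, exists2 A, nbhs r A & P A) ->
  exists n : nat, forall r : R, 0 <= r <= 1 -> P `[r, r + n.+1%:R^-1]%classic.
Proof.
move=> Pmono Ploc.
have /compact_near_coveringP cov := @segment_compact R 0 1.
have [|N _ HN] :=
    cov _ \oo (fun n r => P `[r, r + n.+1%:R^-1]%classic) _.
  move=> /= r _; have [A /nbhs_ballP[e /= e0 eA] PA] := Ploc r.
  have e20 : 0 < e / 2 by rewrite divr_gt0.
  near=> s n; apply: Pmono PA => q; rewrite /= in_itv /= => sq.
  apply: eA; rewrite -ball_normE /= ltr_norml.
  have : n.+1%:R^-1 < e / 2.
    by near: n; exact: (near_infty_natSinv_lt (PosNum e20)).
  have : `|r - s| < e / 2.
    by near: s; apply/nbhs_ballP; exists (e / 2).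
  move: sq; rewrite ltr_norml; move: (n.+1%:R^-1) => w; lra.
by exists N => r r01; apply: (HN N (leqnn N)); rewrite /= in_itv.
Unshelve. all: by end_near. Qed.

(** Induction on the number of pieces. With G and A the initial arcs of g and f
    up to t k, and g', f' the next arcs, [G g' (A f')^-1] is the product of
    [G A^-1] and of the class of the lasso on A around g' f'^-1, which is a
    loop in V k. *)
Lemma subdivided_class_small H U (x : X) (f g : path R x0 x)
    (n : nat) (t : nat -> R) (V : nat -> set X) :
    normal_subgroup H -> U x0 -> t 0%N = 0 ->
    (forall i, (i < n)%N -> forall r, t i <= r <= t i.+1 ->
      V i (g (clamp r)) /\ tame H U (V i) f r) ->
    (forall i, (i < n)%N -> t i <= t i.+1) ->
    (forall i, (i <= n)%N -> g (clamp (t i)) = f (clamp (t i))) ->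
  forall k, (k <= n)%N ->
  forall y (gy : g (clamp (t k)) = y) (fy : f (clamp (t k)) = y),
    small_mod H U (loop_class
      (concat (arc (path_clamp0 g) gy) (reverse (arc (path_clamp0 f) fy)))).
Proof.
move=> nH Ux0 t0 VE tmono gf; elim=> [_|k IH kn] y gy fy.
  have yx0 : y = x0 by rewrite -fy t0 path_clamp0.
  move: gy fy; rewrite yx0 t0 => gy fy.
  rewrite !arc_trivial -based_class_cst based_class_id.
  exact: small_mod1.
have gk := gf _ (ltnW kn); have tk := tmono _ kn.
pose gseg := arc gk gy.
pose fseg := arc (erefl (f (clamp (t k)))) fy.
pose A := initial_arc f (t k).
pose B := arc (path_clamp0 f) fy.
have -> : loop_class (concat (arc (path_clamp0 g) gy) (reverse B)) =
    based_class (arc (path_clamp0 g) gk) B gseg.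
  apply/loop_classP; rewrite homotopic_arc_concat; reflexivity.
have -> : based_class (arc (path_clamp0 g) gk) B gseg =
    (based_class (arc (path_clamp0 g) gk) A (const_path _) *
     based_class A B gseg)%g.
  rewrite -based_class_concat; apply: based_class_homotopic; try reflexivity.
  by rewrite homotopic_concat_cstl; reflexivity.
apply: small_modM => //.
  by rewrite based_class_cst; apply: IH; exact: ltnW.
have fone : based_class A B fseg = 1%g.
  rewrite -(based_class_prefix A fseg).
  apply: based_class_homotopic; try reflexivity.
  by symmetry; exact: homotopic_arc_concat.
have -> : based_class A B gseg =
    loop_class (lasso A (concat gseg (reverse fseg))).
  rewrite based_class_lasso (based_class_concat _ B) based_class_reverse fone.
  by rewrite invg1 mulg1.
have tkk : t k <= t k <= t k.+1 by rewrite lexx.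
have [_ [_ small]] := VE _ kn _ tkk.
apply: small; apply: range_concat.
- apply: range_arc => r rt; apply: (VE _ kn r _).1.
  by case/orP: rt => /andP[? ?]; lra.
- suff : range fseg `<=` V k by move=> fV _ [s _ <-]; exact: fV.
  apply: range_arc => r rt; apply: (VE _ kn r _).2.1.
  by case/orP: rt => /andP[? ?]; lra.
Qed.

Lemma path_Hausdorff_of_Hausdorff H :
  normal_subgroup H -> H_SLT H -> homotopically_Hausdorff H ->
  homotopically_path_Hausdorff H.
Proof.
move=> nH slt hH x alpha beta.
set a := loop_class _ => Ha.
have HaV : ~ H a^-1%g by move=> /(normal_subgroupV nH); rewrite invgK.
have [U [oU Ux0 noU]] := hH x0 (const_path x0) _ HaV.
have [||n Hn] := @segment_lebesgue_number
    (fun A => exists2 V, open V & A `<=` tame H U V alpha).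
- by move=> A B AB [V oV BV]; exists V => //; exact: subset_trans BV.
- move=> r; have [V [oV nV]] := locally_tame alpha slt oU Ux0 r.
  by exists (tame H U V alpha) => //; exists V.
pose t (i : nat) : R := i%:R / n.+1%:R.
have n0 : 0 < n.+1%:R :> R by rewrite ltr0n.
have tS i : t i.+1 = t i + n.+1%:R^-1 by rewrite /t -natr1 mulrDl mul1r.
have t01 i : (i <= n.+1)%N -> 0 <= t i <= 1.
  by move=> ni; rewrite divr_ge0//= ler_pdivrMr// mul1r ler_nat.
have tlt i : t i < t i.+1 by rewrite tS ltrDl invr_gt0.
have t1 : t n.+1 = 1 by rewrite /t divff// gt_eqF.
have t0 : t 0%N = 0 by rewrite /t mul0r.
have /choice[V HV] i : exists V, (i < n.+1)%N ->
    open V /\ `[t i, t i.+1]%classic `<=` tame H U V alpha.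
  have [ni|_] := boolP (i < n.+1)%N; last by exists setT.
  have [V oV tV] := Hn _ (t01 _ (ltnW ni)).
  by exists V; rewrite tS.
exists n.+1, (fun i => clamp (t i)), V; split.
- by rewrite t0.
- by rewrite t1.
- by move=> i ni; rewrite !clampE ?t01// ltnW.
- move=> i ni; have [oV tV] := HV _ ni; split=> // _ [s /= sI <-].
  move: sI; rewrite !clampE ?t01// 1?ltnW// => sI.
  by rewrite -(clamp_val s); apply: (tV (ui_val s) _).1; rewrite /= in_itv.
move=> gamma gV gammat Hgb; apply: noU.
have gE : gamma (clamp (t n.+1)) = x by rewrite t1 path_clamp1.
have aE : alpha (clamp (t n.+1)) = x by rewrite t1 path_clamp1.
have Vgood i : (i < n.+1)%N -> forall r, t i <= r <= t i.+1 ->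
    V i (gamma (clamp r)) /\ tame H U (V i) alpha r.
  move=> ni r ri; have [_ tV] := HV _ ni; split; last first.
    by apply: tV; rewrite /= in_itv.
  apply: (gV i ni); exists (clamp r) => //=.
  have := t01 _ ni; have := t01 _ (ltnW ni) => ? ?.
  by rewrite !clampE//; lra.
have [k kU] := @subdivided_class_small H U x alpha gamma n.+1 t V nH Ux0 t0
  Vgood (fun i _ => ltW (tlt i)) gammat _ (leqnn _) _ gE aE.
move: gE aE; rewrite t1 => gE aE; rewrite !arc_full => Hk.
exists k => //; rewrite lasso_cst.
set d := loop_class _ in Hk.
have Hda : H (d * a)%g by rewrite -loop_class_triangle.
(* As H contains d k^-1 and d a, it contains (d k^-1)^-1 (d a) = k a. *)
exists ((d * (loop_class k)^-1)^-1 * (d * a))%g.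
  by apply: normal_subgroupM => //; exact: normal_subgroupV.
by rewrite invgM invgK !mulgA mulgVK mulgK.
Qed.

End path_Hausdorff_of_Hausdorff.

(** * From path Hausdorff to Hausdorff *)

Section Hausdorff_of_path_Hausdorff.
Context {R : realType} {X : topologicalType} {x0 : X}.
Local Notation I := (unit_interval R).

Section delay.
Context {c : R}.

(** Time change that turns f * k into a path following f at its own times until
    c: it has slope 1/2 on [0, c], undoing the speed 2 of the concatenation,
    then constant slope up to the value 1. It is a convex function, hence a
    maximum of two affine ones. *)
Definition delay (s : I) : R :=
  Num.max (ui_val s / 2) (1 - (1 - ui_val s) * ((1 - c / 2) / (1 - c))).

Lemma delay_continuous : continuous delay.
Proof.
have cI : continuous (@ui_val R) by exact: val_continuous.
apply: continuous_maxf.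
  by apply: continuous_mulf => //; exact: cst_continuous.
apply: continuous_subf; first exact: cst_continuous.
apply: continuous_mulf; last exact: cst_continuous.
by apply: continuous_subf => //; exact: cst_continuous.
Qed.

Lemma delay_one : delay one = 1.
Proof.
by rewrite /delay val_one subrr mul0r subr0 mul1r; apply/max_idPr; lra.
Qed.

Lemma delay_slope : 0 <= c -> c < 1 ->
  1 <= (1 - c / 2) / (1 - c) /\
  (1 - c) * ((1 - c / 2) / (1 - c)) = 1 - c / 2.
Proof.
move=> c0 c1; split; first by rewrite ler_pdivlMr; lra.
by rewrite mulrC divfK// subr_eq0 gt_eqF.
Qed.

Lemma delay_before s : 0 <= c -> c < 1 -> ui_val s <= c ->
  delay s = ui_val s / 2.
Proof.
move=> c0 c1 sc; have [k1 kE] := delay_slope c0 c1.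
rewrite /delay; apply/max_idPl.
by move: ((1 - c / 2) / (1 - c)) k1 kE => k k1 kE; nra.
Qed.

Lemma delay_zero : 0 <= c -> c < 1 -> delay zero = 0.
Proof. by move=> c0 c1; rewrite delay_before ?val_zero ?mul0r. Qed.

Lemma delay_after s : 0 <= c -> c < 1 -> c <= ui_val s ->
  c / 2 <= delay s <= 1.
Proof.
move=> c0 c1 cs; have [k1 kE] := delay_slope c0 c1.
have /andP[s0 s1] := ui_itv s.
rewrite /delay le_max ge_max; apply/andP; split; first by apply/orP; left; lra.
move: ((1 - c / 2) / (1 - c)) k1 kE => k k1 kE.
by apply/andP; split; nra.
Qed.

End delay.

(** A loop k inserted at the end of f can be run through within [c, 1], together
    with the last part of f. *)
Lemma insert_loop (x : X) (f : path R x0 x) (k : path R x x) (c : R) :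
    0 <= c -> c < 1 ->
  exists g : path R x0 x,
    [/\ homotopic g (concat f k),
        forall s, ui_val s <= c -> g s = f s
      & forall (A : set X), range k `<=` A ->
          (forall s, c <= ui_val s -> A (f s)) ->
        forall s, c <= ui_val s -> A (g s)].
Proof.
move=> c0 c1.
exists (reparametrised (concat f k) (@delay_continuous c)
  (delay_zero c0 c1) delay_one).
split; first exact: homotopic_reparametrised.
- move=> s sc; have /andP[s0 s1] := ui_itv s.
  rewrite reparametrisedE (delay_before c0 c1 sc) concatE clampE; last lra.
  rewrite ifT; last lra.
  by rewrite mulrC divfK ?pnatr_eq0// clamp_val.
- move=> A kA fA s cs; have /andP[d0 d1] := delay_after c0 c1 cs.
  rewrite reparametrisedE concatE clampE; last lra.
  case: ifPn => h; last by apply: kA; eexists.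
  by apply: fA; rewrite clampE; lra.
Qed.

(** The neighbourhood of alpha(1) is the open set of the last piece of a
    subdivision for alpha and beta = d * alpha, with d a loop of class g. *)
Lemma Hausdorff_of_path_Hausdorff (H : set (pi1 R x0)) :
  normal_subgroup H -> homotopically_path_Hausdorff H ->
  homotopically_Hausdorff H.
Proof.
move=> nH pH x alpha g Hg.
pose beta := concat (repr g) alpha.
have betaE : loop_class (concat alpha (reverse beta)) = g^-1%g.
  rewrite loop_class_swap; congr (_^-1)%g; rewrite -[RHS]loop_class_repr.
  apply/loop_classP; rewrite -homotopic_concatA homotopic_concat_reverse.
  by rewrite homotopic_concat_cstr; reflexivity.
have [|n [t [U [t0 tn tlt tU noH]]]] := pH x alpha beta.
  by rewrite betaE => /(normal_subgroupV nH); rewrite invgK.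
case: n => [|n] in tn tlt tU noH.
  by move/eqP: (@val_one R); rewrite -tn t0 val_zero eq_sym oner_eq0.
have tmono i j : (i <= j <= n)%N -> ui_val (t i) <= ui_val (t j).
  move=> /andP[]; elim: j => [|j IH]; first by rewrite leqn0 => /eqP ->.
  rewrite leq_eqVlt => /orP[/eqP -> //|ij] jn.
  by apply: le_trans (IH ij (ltnW jn)) _; apply/ltW/tlt/ltnW.
have [oU aU] := tU _ (ltnSn n).
have tn1 : ui_val (t n) < 1 by rewrite -val_one -tn tlt.
have /andP[tn0 _] := ui_itv (t n).
have aUs s : ui_val (t n) <= ui_val s -> U n (alpha s).
  move=> ns; apply: aU; exists s => //=; rewrite ns tn val_one.
  by case/andP: (ui_itv s).
exists (U n); split=> //.
  by rewrite -(path_one (s := alpha)); apply: aUs; rewrite val_one ltW.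
move=> [k kU [h Hh hE]].
have [f [fE fbefore fafter]] := insert_loop alpha k tn0 tn1.
apply: (noH f) => [i|i|].
- rewrite ltnS leq_eqVlt => /orP[/eqP ->|ni] _ [s /andP[is_ si] <-].
    by apply: fafter is_.
  rewrite fbefore; last by apply: le_trans si (tmono _ _ _); rewrite ni leqnn.
  have [_] := tU _ (ltnW ni); apply; exists s => //=.
  by rewrite is_.
- rewrite leq_eqVlt ltnS => /orP[/eqP ->|ni].
    by rewrite tn !path_one.
  by rewrite fbefore// tmono// ni leqnn.
- suff -> : loop_class (concat f (reverse beta)) = h by [].
  have -> : loop_class (concat f (reverse beta)) = based_class alpha beta k.
    by apply/loop_classP; rewrite fE; reflexivity.
  have -> : based_class alpha beta k =
      (based_class alpha alpha k * based_class alpha beta (const_path x))%g.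
    rewrite -based_class_concat; apply: based_class_homotopic; try reflexivity.
    by rewrite homotopic_concat_cstr; reflexivity.
  by rewrite -based_class_lasso based_class_cst betaE -hE mulgK.
Qed.

End Hausdorff_of_path_Hausdorff.

Theorem theorem2p4 (R : realType) (X : topologicalType) (x0 : X)
    (H : set (pi1 R x0)) :
  path_connected R X ->
  normal_subgroup H ->
  H_SLT H ->
  (homotopically_path_Hausdorff H <-> homotopically_Hausdorff H).
Proof.
move=> _ nH slt; split; first exact: Hausdorff_of_path_Hausdorff.
exact: path_Hausdorff_of_Hausdorff.
Qed.
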